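(* Let $T=\sum_{k=0}^{N-1}q_kX^k$ be a circulant bistochastic matrix ($\vec q$ a probability vector), with eigen-decomposition $T=\sum_{n=0}^{N-1}\xi_n|x_n\rangle\langle x_n|$, where $|x_n\rangle=\frac1{\sqrt N}\sum_j\omega^{jn}|j\rangle$ and $\xi_n=\sum_k\omega^{-nk}q_k$. Then $T\in\mathcal{A}_N^C$ if and only if there exist logarithms $\ell_n$ ($e^{\ell_n}=\xi_n$, $n=1,\dots,N-1$) with $\overline{\ell_n}=\ell_{-n\oplus N}$ such that for every $m=1,\dots,N-1$ $$t_m=\frac1N\sum_{n=1}^{N-1}\omega^{mn}\,\ell_n$$ is real and non-negative. In that case $T=\exp(\sum_{m=1}^{N-1}t_m\mathcal{K}_m)$.
   Context: Let $N\ge2$, $\omega=e^{2\pi i/N}$, $X$ the $N\times N$ cyclic shift $X|j\rangle=|j\oplus1\rangle$ (addition mod $N$), $\mathcal{K}_m=X^m-\mathbb{I}_N$. $\mathcal{A}_N^C$ is the set of matrices $\exp(\sum_{m=1}^{N-1}t_m\mathcal{K}_m)$ with all $t_m\ge0$. *)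

(* Defs.v *)
From HB Require Import structures.
From mathcomp Require Import all_boot all_order all_algebra.
From mathcomp Require Import complex.
From mathcomp Require Import all_classical all_reals all_analysis.
Set Implicit Arguments. Unset Strict Implicit. Unset Printing Implicit Defensive.
Import Order.TTheory GRing.Theory Num.Theory.
Local Open Scope ring_scope.
Local Open Scope complex_scope.

Definition shiftmx (R : pzRingType) (N : nat) : 'M[R]_N :=
  \matrix_(i < N, j < N) (((i : nat) == (j.+1 %% N)%N)%:R).

Definition Kmx (R : pzRingType) (N m : nat) : 'M[R]_N :=
  (shiftmx R N) ^+ m - 1%:M.

Definition mxexp (R : realType) (N : nat) (A : 'M[R]_N) : 'M[R]_N :=
  \matrix_(i < N, j < N)
     limn (fun n : nat => \sum_(k < n) ((A ^+ k) i j / (k`!)%:R)).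

Definition in_AC (R : realType) (N : nat) (T : 'M[R]_N) : Prop :=
  exists t : nat -> R, (forall m, (1 <= m < N)%N -> 0 <= t m) /\
    T = mxexp (\sum_(1 <= m < N) t m *: Kmx R N m).

Definition cexp (R : realType) (z : R[i]) : R[i] :=
  (expR (@complex.Re R z))%:C * (cos (@complex.Im R z) +i* sin (@complex.Im R z)).

Definition omega (R : realType) (N : nat) : R[i] :=
  cos (2 * pi / N%:R) +i* sin (2 * pi / N%:R).

Definition xi (R : realType) (N : nat) (q : nat -> R) (n : nat) : R[i] :=
  \sum_(k < N) (omega R N) ^- (n * k) * (q k)%:C.

Definition circulant (R : realType) (N : nat) (q : nat -> R) : 'M[R]_N :=
  \sum_(k < N) q k *: (shiftmx R N) ^+ k.

Definition tcoef (R : realType) (N : nat) (l : nat -> R[i]) (m : nat) : R[i] :=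
  (N%:R)^-1 * \sum_(1 <= n < N) (omega R N) ^+ (m * n) * l n.

Definition good_logs (R : realType) (N : nat) (q : nat -> R) (l : nat -> R[i]) : Prop :=
  (forall n, (1 <= n < N)%N -> cexp (l n) = xi N q n) /\
  (forall n, (1 <= n < N)%N -> conjc (l n) = l (N - n)%N) /\
  (forall m, (1 <= m < N)%N -> @complex.Im R (tcoef N l m) = 0 /\ 0 <= @complex.Re R (tcoef N l m)).

(* Main.v *)
(* Every matrix involved is a polynomial in the shift X, hence diagonal in the Fourier basis,
   and the spectrum determines it.  The exponent sum t_m K_m has eigenvalues
   lambda_n = sum_m t_m (omega^{-nm} - 1), and its exponential has eigenvalues e^{lambda_n}.
   Since lambda_0 = 0, orthogonality of the powers of omega makes t |-> lambda invertible, with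
   inverse l |-> (1/N) sum_{n >= 1} omega^{mn} l_n; so T = exp(sum t_m K_m) says exactly that the
   lambda_n are logarithms of the xi_n from which the t_m are recovered.  The entrywise limit
   defining the matrix exponential reduces to sum_k z^k/k! -> e^z, proved from a Taylor bound
   for s |-> e^{sz} on [0, 1]. *)
Require Import Defs.
From HB Require Import structures.
From mathcomp Require Import all_boot all_order all_algebra.
From mathcomp Require Import complex.
From mathcomp Require Import all_classical all_reals all_analysis.
From mathcomp Require Import ring.
Import Order.TTheory GRing.Theory Num.Theory.
Import numFieldNormedType.Exports.
Local Open Scope ring_scope.
Local Open Scope complex_scope.

(** * Convergence of the complex exponential series, by real calculus *)

Lemma le_norm_of_derive {R : realType} (f g df dg : R -> R) :
  (forall x, is_derive x (1 : R) f (df x)) -> (forall x, is_derive x (1 : R) g (dg x)) ->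
  f 0 = 0 -> g 0 = 0 ->
  (forall x, 0 <= x <= 1 -> `|df x| <= dg x) ->
  forall x, 0 <= x <= 1 -> `|f x| <= g x.
Proof.
move=> Df Dg f0 g0 le_d.
have mono (h dh : R -> R) : (forall x, is_derive x (1 : R) h (dh x)) -> h 0 = 0 ->
    (forall x, 0 <= x <= 1 -> 0 <= dh x) -> forall x, 0 <= x <= 1 -> 0 <= h x.
  move=> Dh h0 dh_ge0 x /andP[x0 x1]; rewrite -h0.
  apply: (@ger0_derive1_ndecr _ h 0 1) => // [y|].
  - rewrite in_itv /= => /andP[y0 y1]; rewrite derive1E (@derive_val _ _ _ _ _ _ _ (Dh y)).
    by rewrite dh_ge0 // !ltW.
  - apply: continuous_subspaceT => y.
    by apply/differentiable_continuous/derivable1_diffP/ex_derive; exact: Dh.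
(* Both [g + f] and [g - f] vanish at 0 and have non-negative derivative on [0, 1], so [mono]
   applies to each. *)
move=> x x01; rewrite ler_norml; apply/andP; split.
  rewrite -subr_ge0 opprK.
  apply: (mono (fun x => f x + g x) (fun x => df x + dg x)) => //= [|y y01].
  - by rewrite f0 g0 addr0.
  - by have := le_d _ y01; rewrite ler_norml => /andP[+ _]; rewrite -subr_ge0 opprK.
rewrite -subr_ge0; apply: (mono (fun x => g x - f x) (fun x => dg x - df x)) => //= [|y y01].
- by rewrite f0 g0 subr0.
- by have := le_d _ y01; rewrite ler_norml subr_ge0 => /andP[].
Qed.

(** At a real s its value is the real part of the n-term partial sum of e^{sz}. Treating the two
    parts as real polynomials in s allows real derivatives throughout. *)
Definition re_exp_poly {R : realType} (z : R[i]) (n : nat) : {poly R} :=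
  \poly_(k < n) (complex.Re (z ^+ k) / k`!%:R).

Definition im_exp_poly {R : realType} (z : R[i]) (n : nat) : {poly R} :=
  \poly_(k < n) (complex.Im (z ^+ k) / k`!%:R).

Lemma ReM {R : realType} (z w : R[i]) :
  complex.Re (z * w) = complex.Re z * complex.Re w - complex.Im z * complex.Im w.
Proof. by case: z w => [a b] [c d]. Qed.

Lemma ImM {R : realType} (z w : R[i]) :
  complex.Im (z * w) = complex.Re z * complex.Im w + complex.Im z * complex.Re w.
Proof. by case: z w => [a b] [c d]. Qed.

Lemma Re_sum {R : realType} I (r : seq I) (P : pred I) (F : I -> R[i]) :
  complex.Re (\sum_(i <- r | P i) F i) = \sum_(i <- r | P i) complex.Re (F i).
Proof. by apply: big_morph => // -[a b] [c d]. Qed.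

Lemma Im_sum {R : realType} I (r : seq I) (P : pred I) (F : I -> R[i]) :
  complex.Im (\sum_(i <- r | P i) F i) = \sum_(i <- r | P i) complex.Im (F i).
Proof. by apply: big_morph => // -[a b] [c d]. Qed.

Lemma Re_mul_real {R : realType} (z : R[i]) (a : R) :
  complex.Re (z * a%:C) = complex.Re z * a.
Proof. by rewrite ReM /= mulr0 subr0. Qed.

Lemma Im_mul_real {R : realType} (z : R[i]) (a : R) :
  complex.Im (z * a%:C) = complex.Im z * a.
Proof. by rewrite ImM /= mulr0 add0r. Qed.

Lemma natr_complexV {R : realType} n : (n%:R^-1 : R)%:C = n%:R^-1 :> R[i].
Proof. by rewrite fmorphV rmorph_nat. Qed.

Lemma factSV {R : realType} n : n.+1`!%:R^-1 * n.+1%:R = n`!%:R^-1 :> R.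
Proof. by rewrite factS natrM invfM mulrC mulVKf // pnatr_eq0. Qed.

(** Differentiating a partial sum of e^{sz} in s gives z times the partial sum with one term fewer;
    this is the real part of that identity, and the next lemma is the imaginary part. *)
Lemma deriv_re_exp_poly {R : realType} (z : R[i]) n :
  (re_exp_poly z n.+1)^`() =
  complex.Re z *: re_exp_poly z n - complex.Im z *: im_exp_poly z n.
Proof.
apply/polyP => k; rewrite coef_deriv coefB !coefZ !coef_poly ltnS.
case: ifP => _; last by rewrite mul0rn !mulr0 subr0.
by rewrite exprS ReM -[_ *+ k.+1]mulr_natr -mulrA factSV; ring.
Qed.

Lemma deriv_im_exp_poly {R : realType} (z : R[i]) n :
  (im_exp_poly z n.+1)^`() =
  complex.Re z *: im_exp_poly z n + complex.Im z *: re_exp_poly z n.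
Proof.
apply/polyP => k; rewrite coef_deriv coefD !coefZ !coef_poly ltnS.
case: ifP => _; last by rewrite mul0rn !mulr0 addr0.
by rewrite exprS ImM -[_ *+ k.+1]mulr_natr -mulrA factSV; ring.
Qed.

(** Induction on n: the derivative of each remainder is z times the previous remainder, and the
    bounds are related in the same way with |x| + |y| in place of z, so [le_norm_of_derive]
    integrates the estimate. *)
Lemma exp_taylor_bound {R : realType} (z : R[i]) n (s : R) :
  let x := complex.Re z in let y := complex.Im z in
  let b := expR `|x| * ((`|x| + `|y|) ^+ n / n`!%:R) * s ^+ n in
  0 <= s <= 1 ->
  `|expR (x * s) * cos (y * s) - (re_exp_poly z n).[s]| <= b /\
  `|expR (x * s) * sin (y * s) - (im_exp_poly z n).[s]| <= b.
Proof.
move=> x y; elim: n s => [|n IH] s b s01.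
  rewrite /b /re_exp_poly /im_exp_poly !poly_def !big_ord0 !horner0 !subr0 !expr0 divr1 !mulr1.
  have le_exp : expR (x * s) <= expR `|x|.
    rewrite ler_expR; case/andP: s01 => s0 s1.
    by rewrite (le_trans (ler_norm _)) // normrM (ger0_norm s0) ler_piMr.
  rewrite !normrM !(ger0_norm (expR_ge0 _)).
  split; rewrite -[leRHS]mulr1 ler_pM ?expR_ge0 //.
    by rewrite ler_norml cos_geN1 cos_le1.
  by rewrite ler_norml sin_geN1 sin_le1.
set M := expR `|x|; set c : R := `|x| + `|y|.
have Dl (a t : R) : is_derive t (1 : R) (fun t => a * t) a.
  by have := is_deriveZ a (is_derive_id t (1 : R)); rewrite /GRing.scale /= mulr1.
have De (t : R) : is_derive t (1 : R) (fun t : R => expR (x * t)) (expR (x * t) * x).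
  exact: (@is_derive1_comp _ expR (fun t => x * t)).
have Dc (t : R) : is_derive t (1 : R) (fun t : R => cos (y * t)) (- sin (y * t) * y).
  exact: (@is_derive1_comp _ cos (fun t => y * t)).
have Ds (t : R) : is_derive t (1 : R) (fun t : R => sin (y * t)) (cos (y * t) * y).
  exact: (@is_derive1_comp _ sin (fun t => y * t)).
have Dg (t : R) : is_derive t (1 : R) (fun t => M * (c ^+ n.+1 / n.+1`!%:R) * t ^+ n.+1)
    (c * (M * (c ^+ n / n`!%:R) * t ^+ n)).
  set K := M * _.
  rewrite (_ : (fun t => K * t ^+ n.+1) = horner (K *: 'X^(n.+1))); last first.
    by apply/funext => u; rewrite hornerZ hornerXn.
  apply: (is_derive_eq (is_derive_poly _ _)).
  rewrite derivZ derivXn hornerZ hornerMn hornerXn /K.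
  by rewrite exprS -(factSV n) -[_ *+ n.+1]mulr_natr; ring.
(* Multiplication by x + iy enlarges a common bound on the real and imaginary parts by at most the
   factor |x| + |y|. *)
have bound (u v B : R) : `|u| <= B -> `|v| <= B ->
    `|x * u - y * v| <= c * B /\ `|x * v + y * u| <= c * B.
  move=> uB vB.
  by rewrite /c mulrDl; split;
    rewrite (le_trans (ler_normD _ _)) // ?normrN !normrM lerD // ler_wpM2l.
have g0 : M * (c ^+ n.+1 / n.+1`!%:R) * 0 ^+ n.+1 = 0 by rewrite expr0n mulr0.
(* [u] and [v] are the remainders of order n; those of order n + 1 have as derivatives the real and
   imaginary parts of z (u + iv). *)
pose u t := expR (x * t) * cos (y * t) - (re_exp_poly z n).[t].
pose v t := expR (x * t) * sin (y * t) - (im_exp_poly z n).[t].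
split.
  apply: (@le_norm_of_derive R (fun t => expR (x * t) * cos (y * t) - (re_exp_poly z n.+1).[t])
    (fun t => M * (c ^+ n.+1 / n.+1`!%:R) * t ^+ n.+1) (fun t => x * u t - y * v t)
    _ _ Dg _ g0 _ s s01) => [t||t t01].
  - apply: (is_derive_eq (is_deriveB (is_deriveM (De t) (Dc t)) (is_derive_poly _ _))).
    rewrite deriv_re_exp_poly hornerD hornerN !hornerZ /u /v /GRing.scale /=; ring.
  - rewrite !mulr0 expR0 cos0 horner_coef0 coef_poly /= divr1; ring.
  - by have [h1 h2] := IH t t01; have [] := bound _ _ _ h1 h2.
apply: (@le_norm_of_derive R (fun t => expR (x * t) * sin (y * t) - (im_exp_poly z n.+1).[t])
    (fun t => M * (c ^+ n.+1 / n.+1`!%:R) * t ^+ n.+1) (fun t => x * v t + y * u t)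
    _ _ Dg _ g0 _ s s01) => [t||t t01].
- apply: (is_derive_eq (is_deriveB (is_deriveM (De t) (Ds t)) (is_derive_poly _ _))).
  rewrite deriv_im_exp_poly hornerD !hornerZ /u /v /GRing.scale /=; ring.
- rewrite !mulr0 expR0 sin0 horner_coef0 coef_poly /=; ring.
- by have [h1 h2] := IH t t01; have [] := bound _ _ _ h1 h2.
Qed.

(** At s = 1 the Taylor bound is a constant times c^n / n!, a term of an exponential series, hence
    tends to 0. *)
Lemma exp_series_cvg {R : realType} (z : R[i]) :
  ((fun n : nat => complex.Re (\sum_(k < n) z ^+ k / k`!%:R)) @ \oo -->
    complex.Re (cexp z))%classic /\
  ((fun n : nat => complex.Im (\sum_(k < n) z ^+ k / k`!%:R)) @ \oo -->
    complex.Im (cexp z))%classic.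
Proof.
set M := expR `|complex.Re z|.
have bound0 : ((fun n => M * exp_coeff (`|complex.Re z| + `|complex.Im z|) n) @ \oo --> 0)%classic.
  by rewrite -(mulr0 M); apply: cvgMr; exact: cvg_exp_coeff.
have squeeze (a : R) (e : nat -> R) :
    (forall n, `|a - e n| <= M * exp_coeff (`|complex.Re z| + `|complex.Im z|) n) ->
    (e @ \oo --> a)%classic.
  move=> e_le; apply/cvgrPdist_le => eps eps0.
  move/cvgrPdist_le: bound0 => /(_ _ eps0); apply: filterS => n; rewrite sub0r normrN.
  by apply: le_trans; rewrite (le_trans (e_le n)) // ler_norm.
have unit1 : 0 <= (1 : R) <= 1 by rewrite ler01 lexx.
have taylor n := @exp_taylor_bound R z n 1 unit1.
split; apply: squeeze => n; have := taylor n; rewrite /= !mulr1 expr1n mulr1 !horner_poly.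
  rewrite Re_sum => -[+ _]; congr (`|_ - _| <= _); first by rewrite /cexp /=; ring.
  by apply: eq_bigr => k _; rewrite expr1n mulr1 -natr_complexV Re_mul_real.
rewrite Im_sum => -[_ +]; congr (`|_ - _| <= _); first by rewrite /cexp /=; ring.
by apply: eq_bigr => k _; rewrite expr1n mulr1 -natr_complexV Im_mul_real.
Qed.

(** * Roots of unity and the discrete Fourier transform *)

Lemma omegaX {R : realType} N k :
  omega R N ^+ k = cos (2 * pi / N%:R * k%:R) +i* sin (2 * pi / N%:R * k%:R).
Proof.
rewrite /omega; set a := 2 * pi / N%:R.
elim: k => [|k IH]; first by rewrite expr0 mulr0 cos0 sin0.
rewrite exprSr IH (_ : a * k.+1%:R = a * k%:R + a); last by rewrite -natr1; ring.
rewrite cosD sinD.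
by apply/eqP; rewrite eq_complex /= eqxx addrC eqxx.
Qed.

Lemma omega_prim {R : realType} N : (0 < N)%N -> N.-primitive_root (omega R N).
Proof.
move=> N0; have NR0 : N%:R != 0 :> R by rewrite pnatr_eq0 -lt0n.
rewrite /primitive_root_of_unity N0; apply/forallP => i; rewrite unity_rootE omegaX.
have [->|neqiN] := eqVneq i.+1 N.
  by rewrite divfK // mulr_natl cos2pi sin2pi eqxx.
have ltiN : (i.+1 < N)%N by rewrite ltn_neqAle neqiN ltn_ord.
rewrite eq_complex eqbF_neg negb_and; apply/orP; left => /=.
(* With k = i + 1 < N, the angle a = pi k / N lies strictly between 0 and pi, so Re(omega^k) - 1 =
   cos(2a) - 1 = -2 sin(a)^2 is nonzero. *)
set a := pi / N%:R * i.+1%:R : R.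
have -> : 2 * pi / N%:R * i.+1%:R = a *+ 2 :> R by rewrite /a -!mulrA mulr_natl.
rewrite cos_mulr2n -subr_eq0 cos2sin2.
have sin_a : sin a != 0.
  rewrite gt_eqF // sin_gt0_pi // /a !mulr_gt0 ?invr_gt0 ?ltr0n ?pi_gt0 //=.
  by rewrite mulrAC ltr_pdivrMr ?ltr0n // ltr_pM2l ?pi_gt0 // ltr_nat.
have -> : (1 - sin a ^+ 2) *+ 2 - 1 - 1 = - (2 * sin a ^+ 2) by ring.
by rewrite oppr_eq0 mulf_neq0 ?pnatr_eq0 // expf_neq0.
Qed.

Lemma omega_neq0 {R : realType} N : (0 < N)%N -> omega R N != 0.
Proof.
move=> N0; apply/eqP => w0; have := prim_expr_order (@omega_prim R N N0).
by rewrite w0 expr0n eqn0Ngt N0 => /esym/eqP; rewrite oner_eq0.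
Qed.

Lemma conjc_omega {R : realType} N : conjc (omega R N) = (omega R N)^-1.
Proof.
have wJ : omega R N * conjc (omega R N) = 1.
  rewrite /omega; set a := 2 * pi / N%:R.
  apply/eqP; rewrite eq_complex /= -(cos2Dsin2 a) !expr2.
  by rewrite mulrN opprK eqxx mulrN [sin a * _]mulrC addNr eqxx.
have w0 : omega R N != 0.
  by apply/eqP => w0; move: wJ; rewrite w0 mul0r => /esym/eqP; rewrite oner_eq0.
by apply: (mulfI w0); rewrite wJ divff.
Qed.

(** For i <> j the ratio r = omega^i / omega^j differs from 1 by primitivity, and (r - 1) times the
    geometric sum is r^N - 1 = 0. *)
Lemma sum_omega {R : realType} N i j : (i < N)%N -> (j < N)%N ->
  \sum_(n < N) (omega R N ^+ i / omega R N ^+ j) ^+ n = (i == j)%:R * N%:R.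
Proof.
move=> iN jN; have N0 : (0 < N)%N by exact: leq_ltn_trans iN.
have w0 := @omega_neq0 R N N0; have wP := @omega_prim R N N0.
have [->|neq_ij] := eqVneq i j.
  rewrite divff ?expf_neq0 // mul1r (eq_bigr (fun=> 1)) ?sumr_const ?card_ord // => n _.
  by rewrite expr1n.
have neq1 : omega R N ^+ i / omega R N ^+ j - 1 != 0.
  rewrite subr_eq0; apply: contra neq_ij => /eqP/(canRL (mulfVK (expf_neq0 _ w0))).
  by rewrite mul1r => /eqP; rewrite (eq_prim_root_expr wP) !modn_small.
apply: (mulfI neq1); rewrite mul0r mulr0 -subrX1 expr_div_n -!exprM.
by rewrite !(mulnC _ N) !exprM (prim_expr_order wP) !expr1n divr1 subrr.
Qed.

(** Column n is sqrt(N) |x_n>. The whole factor 1/N is put into the inverse, which avoids square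
    roots. *)
Definition fourier_mx (R : realType) N : 'M[R[i]]_N :=
  \matrix_(i, n) omega R N ^+ (n * i).

Definition fourier_inv_mx (R : realType) N : 'M[R[i]]_N :=
  \matrix_(n, j) (N%:R^-1 * omega R N ^- (n * j)).

Lemma fourierK {R : realType} N : fourier_mx R N *m fourier_inv_mx R N = 1%:M.
Proof.
apply/matrixP => i j; have N0 : (0 < N)%N by exact: leq_ltn_trans (ltn_ord i).
rewrite !mxE; under eq_bigr => n _.
  rewrite !mxE mulrCA (mulnC n i) (mulnC n j) !exprM -expr_div_n; over.
by rewrite -mulr_sumr sum_omega // mulrCA mulVf ?mulr1 // pnatr_eq0 -lt0n.
Qed.

Lemma fourierVK {R : realType} N : fourier_inv_mx R N *m fourier_mx R N = 1%:M.
Proof. exact/mulmx1C/fourierK. Qed.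

(** * Spectral calculus in the Fourier basis *)

Definition has_spectrum {R : realType} N (M : 'M[R]_N) (mu : nat -> R[i]) :=
  map_mx (real_complex R) M =
  fourier_mx R N *m diag_mx (\row_(n < N) mu n) *m fourier_inv_mx R N.

(** A spectrum is indexed by all of [nat], but only its values below [N] matter; this is used to
    reshape the eigenvalue formulas produced by the closure lemmas. *)
Lemma eq_has_spectrum {R : realType} N (M : 'M[R]_N) mu nu :
  (forall n, (n < N)%N -> mu n = nu n) -> has_spectrum N M mu -> has_spectrum N M nu.
Proof.
move=> eq_mu; rewrite /has_spectrum => ->; do 2!congr (_ *m _); congr diag_mx.
by apply/rowP => n; rewrite !mxE eq_mu.
Qed.

(** Undoing the Fourier conjugation recovers the diagonal matrix, so the eigenvalues are determined
    with their order. Together with [has_spectrum_uniq] this trades matrix equations for equations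
    between eigenvalues. *)
Lemma has_spectrum_inj {R : realType} N (M : 'M[R]_N) mu nu :
  has_spectrum N M mu -> has_spectrum N M nu -> forall n, (n < N)%N -> mu n = nu n.
Proof.
have diagE d : fourier_inv_mx R N *m (fourier_mx R N *m diag_mx d *m fourier_inv_mx R N)
    *m fourier_mx R N = diag_mx d.
  by rewrite !mulmxA fourierVK mul1mx -mulmxA fourierVK mulmx1.
rewrite /has_spectrum => -> eqD n nN.
have /matrixP/(_ (Ordinal nN) (Ordinal nN)) :
    diag_mx (\row_(n < N) mu n) = diag_mx (\row_(n < N) nu n).
  by rewrite -diagE eqD diagE.
by rewrite !mxE eqxx !mulr1n.
Qed.

Lemma has_spectrum_uniq {R : realType} N (M M' : 'M[R]_N) mu :
  has_spectrum N M mu -> has_spectrum N M' mu -> M = M'.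
Proof.
rewrite /has_spectrum => <- /matrixP eqM; apply/matrixP => i j.
by have := eqM i j; rewrite !mxE => /complexI.
Qed.

Lemma has_spectrum1 {R : realType} N : has_spectrum N (1%:M : 'M[R]_N) (fun=> 1).
Proof.
rewrite /has_spectrum map_mx1 (_ : \row_(n < N) 1 = const_mx 1); last first.
  by apply/rowP => n; rewrite !mxE.
by rewrite diag_const_mx mulmx1 fourierK.
Qed.

Lemma has_spectrumD {R : realType} N (M M' : 'M[R]_N) mu mu' :
  has_spectrum N M mu -> has_spectrum N M' mu' ->
  has_spectrum N (M + M') (fun n => mu n + mu' n).
Proof.
rewrite /has_spectrum map_mxD => -> ->; rewrite -mulmxDl -mulmxDr -raddfD /=.
by congr (_ *m diag_mx _ *m _); apply/rowP => n; rewrite !mxE.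
Qed.

Lemma has_spectrumZ {R : realType} N (M : 'M[R]_N) mu a :
  has_spectrum N M mu -> has_spectrum N (a *: M) (fun n => a%:C * mu n).
Proof.
rewrite /has_spectrum map_mxZ => ->; rewrite scalemxAl scalemxAr.
congr (_ *m _ *m _); apply/matrixP => i j; rewrite !mxE.
by rewrite mulrnAr.
Qed.

Lemma has_spectrum_sum {R : realType} N I (r : seq I) (P : pred I)
  (M : I -> 'M[R]_N) (mu : I -> nat -> R[i]) :
  (forall k, P k -> has_spectrum N (M k) (mu k)) ->
  has_spectrum N (\sum_(k <- r | P k) M k) (fun n => \sum_(k <- r | P k) mu k n).
Proof.
move=> specM; elim: r => [|k r IH].
  apply: (@eq_has_spectrum _ _ _ (fun=> 0%:C * 1)) => [n _|]; first by rewrite big_nil mul0r.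
  by rewrite big_nil -(scale0r 1%:M); exact/has_spectrumZ/has_spectrum1.
rewrite big_cons; case Pk: (P k).
  apply: eq_has_spectrum (has_spectrumD _ _ _ _ _ (specM k Pk) IH) => n _.
  by rewrite big_cons Pk.
by apply: eq_has_spectrum IH => n _; rewrite big_cons Pk.
Qed.

Lemma has_spectrumM {R : realType} N (M M' : 'M[R]_N) mu mu' :
  has_spectrum N M mu -> has_spectrum N M' mu' ->
  has_spectrum N (M *m M') (fun n => mu n * mu' n).
Proof.
rewrite /has_spectrum map_mxM => -> ->; rewrite !mulmxA.
rewrite -(mulmxA _ (fourier_inv_mx R N)) fourierVK mulmx1 -(mulmxA (fourier_mx R N)).
rewrite mulmx_diag; congr (_ *m _ *m _); congr diag_mx.
by apply/rowP => n; rewrite !mxE.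
Qed.

Lemma has_spectrumX {R : realType} N (M : 'M[R]_N) mu k :
  has_spectrum N M mu -> has_spectrum N (M ^+ k) (fun n => mu n ^+ k).
Proof.
move=> specM; elim: k => [|k IH]; first exact: has_spectrum1.
rewrite exprS; apply: eq_has_spectrum (has_spectrumM _ _ _ _ _ specM IH) => n _.
by rewrite exprS.
Qed.

(** Row n of the inverse Fourier matrix is a left eigenvector: multiplying by X on the right
    replaces index j by j + 1 mod N, which costs a factor omega^{-n}; the wrap-around is harmless
    because omega^N = 1. *)
Lemma has_spectrum_shift {R : realType} N :
  has_spectrum N (shiftmx R N) (fun n => omega R N ^- n).
Proof.
have FX : fourier_inv_mx R N *m map_mx (real_complex R) (shiftmx R N) =
    diag_mx (\row_(n < N) omega R N ^- n) *m fourier_inv_mx R N.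
  apply/matrixP => n j; have N0 : (0 < N)%N by exact: leq_ltn_trans (ltn_ord n).
  rewrite mul_diag_mx !mxE (bigD1 (Ordinal (ltn_pmod j.+1 N0))) //= big1 ?addr0; last first.
    move=> l neq_l; rewrite !mxE; case: eqP => [eq_l|_]; last by rewrite rmorph0 mulr0.
    by case/eqP: neq_l; exact/val_inj.
  rewrite !mxE eqxx rmorph1 mulr1 mulrCA; congr (_ * _); rewrite -invfM -exprD.
  congr (_^-1); apply/eqP; rewrite (eq_prim_root_expr (omega_prim _ N0)).
  by rewrite modnMmr mulnS addnC.
by rewrite /has_spectrum -mulmxA -FX mulmxA fourierK mul1mx.
Qed.

Lemma has_spectrum_circulant {R : realType} N (q : nat -> R) :
  has_spectrum N (circulant N q) (xi N q).
Proof.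
have specX k : has_spectrum N (q k *: shiftmx R N ^+ k) (fun n => (q k)%:C * (omega R N ^- n) ^+ k).
  exact/has_spectrumZ/has_spectrumX/has_spectrum_shift.
have := has_spectrum_sum _ _ (index_enum 'I_N) xpredT _ _ (fun k _ => specX k).
apply: eq_has_spectrum => n _.
by apply: eq_bigr => k _; rewrite mulrC exprVn exprM.
Qed.

Lemma has_spectrum_generator {R : realType} N (t : nat -> R) :
  has_spectrum N (\sum_(1 <= m < N) t m *: Kmx R N m)
    (fun n => \sum_(1 <= m < N) (t m)%:C * (omega R N ^- (n * m) - 1)).
Proof.
apply: has_spectrum_sum => m _; apply: has_spectrumZ; rewrite /Kmx -scaleN1r.
apply: eq_has_spectrum (has_spectrumD _ _ _ _ _ (has_spectrumX _ _ _ m (has_spectrum_shift N))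
  (has_spectrumZ _ _ _ (-1) (has_spectrum1 N))) => n _.
by rewrite exprVn exprM rmorphN rmorph1 mulr1.
Qed.

(** Each entry is a linear combination of the eigenvalues whose coefficients do not depend on the
    matrix; in this form entrywise limits can be taken. *)
Lemma has_spectrumP {R : realType} N (M : 'M[R]_N) mu :
  has_spectrum N M mu <-> forall i j, (M i j)%:C =
    \sum_(n < N) fourier_mx R N i n * fourier_inv_mx R N n j * mu n.
Proof.
have entry i j : (fourier_mx R N *m diag_mx (\row_(n < N) mu n) *m fourier_inv_mx R N) i j =
    \sum_(n < N) fourier_mx R N i n * fourier_inv_mx R N n j * mu n.
  by rewrite mxE; apply: eq_bigr => n _; rewrite mul_mx_diag !mxE mulrAC.
split=> [/matrixP specM i j|eqM]; first by rewrite -entry -specM mxE.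
by apply/matrixP => i j; rewrite entry -eqM mxE.
Qed.

Lemma has_spectrum_exp {R : realType} N (M : 'M[R]_N) mu :
  has_spectrum N M mu -> has_spectrum N (mxexp M) (fun n => cexp (mu n)).
Proof.
move=> specM; apply/has_spectrumP => i j.
set c := fun n : 'I_N => fourier_mx R N i n * fourier_inv_mx R N n j.
set S := fun K : nat => \sum_(k < K) ((M ^+ k) i j / k`!%:R).
(* By linearity, the partial sums of the matrix series are fixed finite combinations of the scalar
   partial sums at the eigenvalues. *)
have SE K : (S K)%:C = \sum_(n < N) c n * \sum_(k < K) mu n ^+ k / k`!%:R.
  rewrite rmorph_sum /=; under [RHS]eq_bigr do rewrite mulr_sumr.
  rewrite exchange_big /=; apply: eq_bigr => k _.
  rewrite rmorphM /= natr_complexV.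
  have /has_spectrumP -> := has_spectrumX N M mu k specM.
  by rewrite mulr_suml; apply: eq_bigr => n _; rewrite mulrA.
have ReS : (S @ \oo --> complex.Re (\sum_(n < N) c n * cexp (mu n)))%classic.
  rewrite (_ : S = fun K => complex.Re (S K)%:C) // Re_sum.
  under eq_fun do rewrite SE Re_sum.
  apply: cvg_big => [|n _]; first exact: add_continuous.
  rewrite ReM; under eq_fun do rewrite ReM.
  have [cvgRe cvgIm] := exp_series_cvg (mu n).
  by apply: cvgB; apply: cvgMr.
(* The partial sums are real, so their imaginary parts form the zero sequence; its limit shows that
   the spectral expression is real. *)
have ImS : ((fun=> 0 : R) @ \oo --> complex.Im (\sum_(n < N) c n * cexp (mu n)))%classic.
  rewrite (_ : (fun=> 0) = fun K => complex.Im (S K)%:C) // Im_sum.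
  under eq_fun do rewrite SE Im_sum.
  apply: cvg_big => [|n _]; first exact: add_continuous.
  rewrite ImM; under eq_fun do rewrite ImM.
  have [cvgRe cvgIm] := exp_series_cvg (mu n).
  by apply: cvgD; apply: cvgMr.
rewrite mxE (cvg_lim _ ReS) //; apply/eqP; rewrite eq_complex /= eqxx /=.
by rewrite -(cvg_lim _ ImS) // (cvg_lim _ (cvg_cst _)).
Qed.

(** * Inverting the passage from coefficients to eigenvalues *)

Definition generator_spectrum {R : realType} N (t : nat -> R[i]) (n : nat) : R[i] :=
  \sum_(1 <= m < N) t m * (omega R N ^- (n * m) - 1).

Lemma generator_spectrum0 {R : realType} N (t : nat -> R[i]) :
  generator_spectrum N t 0 = 0.
Proof. by apply: big1 => m _; rewrite mul0n expr0 invr1 subrr mulr0. Qed.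

(** The subtracted 1 is omega^{-n 0}, so this is orthogonality used twice, for the exponents k and
    0. *)
Lemma sum_omegaB {R : realType} N m k : (m < N)%N -> (k < N)%N ->
  \sum_(n < N) omega R N ^+ (m * n) * (omega R N ^- (n * k) - 1) =
  ((m == k)%:R - (m == 0%N)%:R) * N%:R.
Proof.
move=> mN kN; have N0 : (0 < N)%N by exact: leq_ltn_trans mN.
rewrite mulrBl -!sum_omega // -sumrB; apply: eq_bigr => n _.
by rewrite expr0 divr1 expr_div_n mulrBr mulr1 (mulnC n k) !exprM.
Qed.

Lemma sum_nat_from1 {R : realType} N (F : nat -> R[i]) : (0 < N)%N -> F 0%N = 0 ->
  \sum_(1 <= n < N) F n = \sum_(n < N) F n.
Proof. by move=> N0 F0; rewrite -(big_mkord xpredT) big_ltn // F0 add0r. Qed.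

Lemma sum_nat_delta {R : realType} N (F : nat -> R[i]) m : (1 <= m < N)%N ->
  \sum_(1 <= k < N) F k * (((m == k)%:R - (m == 0%N)%:R) * N%:R) = F m * N%:R.
Proof.
move=> mN; have /andP[m0 _] := mN.
rewrite (bigD1_seq m) ?mem_index_iota ?iota_uniq //= eqxx (gtn_eqF m0) subr0 mul1r.
rewrite big1 ?addr0 // => k; rewrite eq_sym => /negPf ->.
by rewrite subr0 mul0r mulr0.
Qed.

(** Since lambda_0 = 0, the sum over n can be extended to n = 0; exchanging the sums then leaves
    full-range orthogonality in n. *)
Lemma tcoef_generator_spectrum {R : realType} N (t : nat -> R[i]) m :
  (1 <= m < N)%N -> tcoef N (generator_spectrum N t) m = t m.
Proof.
move=> mN; have N0 : (0 < N)%N by case/andP: mN => _; apply: leq_ltn_trans.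
rewrite /tcoef sum_nat_from1 //; last by rewrite generator_spectrum0 mulr0.
rewrite /generator_spectrum; under eq_bigr do rewrite mulr_sumr.
rewrite exchange_big /= (_ : \sum_(1 <= k < N) _ = t m * N%:R).
  by rewrite mulrC mulfK // pnatr_eq0 -lt0n.
rewrite -(sum_nat_delta _ _ _ mN); apply: eq_big_nat => k /andP[_ kN].
rewrite -sum_omegaB //; last by case/andP: mN.
by rewrite mulr_sumr; apply: eq_bigr => n _; rewrite mulrCA.
Qed.

(** Here the sum over m is the one extended to 0, where the factor omega^{-nm} - 1 vanishes whatever
    the coefficient is. *)
Lemma generator_spectrum_tcoef {R : realType} N (l : nat -> R[i]) n :
  (1 <= n < N)%N -> generator_spectrum N (tcoef N l) n = l n.
Proof.
move=> nN; have N0 : (0 < N)%N by case/andP: nN => _; apply: leq_ltn_trans.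
rewrite /generator_spectrum sum_nat_from1 //; last by rewrite muln0 expr0 invr1 subrr mulr0.
rewrite /tcoef; under eq_bigr do rewrite -mulrA mulr_suml.
rewrite -mulr_sumr exchange_big /= (_ : \sum_(1 <= k < N) _ = l n * N%:R).
  by rewrite mulrC mulfK // pnatr_eq0 -lt0n.
rewrite -(sum_nat_delta _ _ _ nN); apply: eq_big_nat => k /andP[k0 kN].
(* As n and k are both positive, the deltas at 0 vanish, and the roles of n and k can be swapped to
   match [sum_omegaB]. *)
rewrite (_ : (n == k)%:R - (n == 0%N)%:R = (k == n)%:R - (k == 0%N)%:R); last first.
  by case/andP: nN => n0 _; rewrite eq_sym (gtn_eqF n0) (gtn_eqF k0).
rewrite -sum_omegaB //; last by case/andP: nN.
rewrite mulr_sumr; apply: eq_bigr => m _; rewrite (mulnC m k) (mulnC m n); ring.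
Qed.

(** The coefficients are real, and the conjugate of omega^{-nm} is omega^{nm} = omega^{-(N-n)m}. *)
Lemma conjc_generator_spectrum {R : realType} N (t : nat -> R) n : (n <= N)%N ->
  conjc (generator_spectrum N (fun m => (t m)%:C) n) =
  generator_spectrum N (fun m => (t m)%:C) (N - n).
Proof.
move=> nN; case: (posnP N) => [-> |N0]; first by rewrite /generator_spectrum !big_geq // rmorph0.
rewrite rmorph_sum /=; apply: eq_bigr => m _.
have conjX k : conjc (omega R N ^+ k) = omega R N ^- k by rewrite rmorphXn -exprVn -conjc_omega.
have conjM (a b : R[i]) : conjc (a * (b - 1)) = conjc a * (conjc b - 1).
  by rewrite rmorphM rmorphB rmorph1.
rewrite conjM conjc_real conjc_inv conjX.
congr (_ * (_ - _)); rewrite invrK; have w0 := @omega_neq0 R N N0.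
apply: (mulIf (expf_neq0 ((N - n) * m) w0)); rewrite mulVf ?expf_neq0 // -exprD -mulnDl subnKC //.
by rewrite exprM (prim_expr_order (omega_prim N N0)) expr1n.
Qed.

Theorem theorem2 (R : realType) (N : nat) (hN : (2 <= N)%N) (q : nat -> R)
  (hq0 : forall k, (k < N)%N -> 0 <= q k) (hq1 : \sum_(k < N) q k = 1) :
  (in_AC (circulant N q) <-> exists l : nat -> R[i], good_logs N q l) /\
  (forall l : nat -> R[i], good_logs N q l ->
     circulant N q = mxexp (\sum_(1 <= m < N) @complex.Re R (tcoef N l m) *: Kmx R N m)).
Proof.
(* The logarithms start at n = 1; the eigenvalue at n = 0 is settled by the normalization of [q],
   which matches e^{lambda_0} = e^0 = 1. *)
have xi0 : xi N q 0 = 1.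
  rewrite /xi; under eq_bigr do rewrite mul0n expr0 invr1 mul1r.
  by rewrite -rmorph_sum /= hq1.
have expT (l : nat -> R[i]) : good_logs N q l ->
    circulant N q = mxexp (\sum_(1 <= m < N) @complex.Re R (tcoef N l m) *: Kmx R N m).
  move=> [expl [_ t_real]].
  apply: has_spectrum_uniq (has_spectrum_circulant N q) _.
  apply: eq_has_spectrum (has_spectrum_exp _ _ _ (has_spectrum_generator _ _)) => n nN.
  rewrite -/(generator_spectrum N (fun m => (complex.Re (tcoef N l m))%:C) n).
  (* The coefficients have zero imaginary part, so taking real parts changes nothing and the
     inversion formula applies. *)
  have -> : generator_spectrum N (fun m => (complex.Re (tcoef N l m))%:C) n =
      generator_spectrum N (tcoef N l) n.
    apply: eq_big_nat => m mN; congr (_ * _).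
    by have [+ _] := t_real m mN; case: (tcoef N l m) => a b /= ->.
  have [->|n0] := posnP n.
    by rewrite generator_spectrum0 xi0 /cexp /= expR0 cos0 sin0 mul1r.
  by rewrite generator_spectrum_tcoef ?n0 // expl ?n0.
split=> //; split=> [[t [t_ge0 Texp]]|[l good_l]]; last first.
  exists (fun m => complex.Re (tcoef N l m)); split=> [m mN|]; last exact: expT.
  by have [_ [_ /(_ m mN)[]]] := good_l.
(* The logarithms are the eigenvalues of the given generator: comparing spectra shows that they
   exponentiate to the xi_n, and [tcoef] returns the original [t]. *)
exists (generator_spectrum N (fun m => (t m)%:C)); split; last split.
- move=> n /andP[_ nN].
  have := has_spectrum_exp _ _ _ (has_spectrum_generator N t).
  by rewrite -Texp => /(has_spectrum_inj _ _ _ _ (has_spectrum_circulant N q))/(_ n nN) ->.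
- by move=> n /andP[_ nN]; rewrite conjc_generator_spectrum // ltnW.
- by move=> m mN; rewrite tcoef_generator_spectrum //=; split => //; exact: t_ge0.
Qed.
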